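(* Let $J\subset\mathbb N$ be any subset, let $G_i$, $i\in J$, be a chaotic homeomorphism group of a metric space $(X_i,\widetilde d_i)$ with metric bounded by $1$, and let the direct product of groups $G=\prod_{i\in J}G_i$ act canonically on the product of metric spaces $(X,d)=\prod_{i\in J}(X_i,\widetilde d_i)$. If there exists $n\in J$ such that $(X_n,\widetilde d_n)$ is a locally compact metric Baire space, then the group $G$ is chaotic and sensitive to initial conditions.
   Context: A homeomorphism group of $X$ is a group of homeomorphisms of $X$ onto itself (no topology on the group is assumed). The product metric space $(X,d)=\prod_{i\in J}(X_i,\widetilde d_i)$ is $X=\prod_{i\in J}X_i$ with the metric $d(x,y)=\sum_{i\in J}\frac{1}{2^i}\widetilde d_i(x_i,y_i)$, where $\mathbb N=\{1,2,\dots\}$. (The metric $\widetilde d_i$ is obtained from an original metric $d_i$ on $X_i$ as $\widetilde d_i=d_i$ if $d_i$ is bounded by $1$, and $\widetilde d_i=\frac{d_i}{1+d_i}$ otherwise.) The canonical action is $\{g_i\}.\{x_i\}=\{g_i.x_i\}$. The orbit of $x$ is $G.x=\{g.x : g\in G\}$; a closed (non-closed) orbit is an orbit that is (is not) a closed subset of the space. A group of homeomorphisms $G$ of a topological space $X$ is chaotic (acts chaotically) on $X$ if (1) there exists a dense non-closed orbit of $G$ in $X$, and (2) the union of the closed orbits of $G$ is dense in $X$. A Baire space is a topological space in which every countable intersection of open dense subsets is dense. A Hausdorff space is locally compact if each of its points has an open neighborhood with compact closure. A homeomorphism group $G$ of a metric space $(X,d)$ is sensitive to initial conditions if there exists $\delta>0$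 such that for every nonempty open subset $U\subset X$ there exists $g\in G$ with $\operatorname{diam}(g.U)\ge\delta$. *)

(* Defs.v *)
From HB Require Import structures.
From mathcomp Require Import all_boot all_order all_algebra.
From mathcomp Require Import all_classical all_reals all_analysis.
From mathcomp Require Import finmap ring.

Set Implicit Arguments.
Unset Strict Implicit.
Unset Printing Implicit Defensive.

Import Order.TTheory GRing.Theory Num.Theory.
Import numFieldNormedType.Exports.

Local Open Scope classical_set_scope.
Local Open Scope ring_scope.

(* A subgroup of the group of homeomorphisms of [T] onto itself; it carries no
   topology. *)
Record homeo_group (T : topologicalType) := HomeoGroup {
  homeos :> set (T -> T);
  homeo_id : homeos idfun;
  homeo_comp : forall g h, homeos g -> homeos h -> homeos (g \o h);
  homeo_inv : forall g, homeos g ->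
    exists h, [/\ homeos h, cancel g h & cancel h g];
  homeo_continuous : forall g, homeos g -> continuous g
}.

Definition orbit (T : topologicalType) (G : homeo_group T) (x : T) : set T :=
  [set g x | g in homeos G].

Definition closed_orbit (T : topologicalType) (G : homeo_group T) (x : T) :=
  closed (orbit G x).

Definition chaotic (T : topologicalType) (G : homeo_group T) :=
  (exists x, dense (orbit G x) /\ ~ closed_orbit G x) /\
  dense (\bigcup_(x in [set x | closed_orbit G x]) orbit G x).

Definition Baire_space (T : topologicalType) :=
  forall U : nat -> set T,
    (forall k, open (U k) /\ dense (U k)) -> dense (\bigcap_k U k).

Definition diam (R : realType) (T : metricType R) (A : set T) : \bar R :=
  ereal_sup [set (mdist p.1 p.2)%:E | p in A `*` A].

Definition sensitive (R : realType) (T : metricType R) (G : homeo_group T) :=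
  exists2 delta : R, 0 < delta &
    forall U : set T, open U -> U !=set0 ->
      exists2 g, homeos G g & (delta%:E <= diam (g @` U))%E.

Definition bounded_by1 (R : realType) (T : metricType R) :=
  forall x y : T, mdist x y <= 1.

(* The product set with the metric [prod_dist] below (not the library's product
   uniformity). The bound is a parameter of the type because it makes the series
   converge. *)
Definition metric_prod (R : realType) (J : set nat) (X : J -> metricType R)
  (bX : forall i, bounded_by1 (X i)) : Type := forall i, X i.

Section metric_prod.
Context (R : realType) (J : set nat) (X : J -> metricType R).
Context (bX : forall i, bounded_by1 (X i)).
Local Notation P := (metric_prod bX).
Implicit Types x y z : P.

Definition prod_edist x y : \bar R :=
  (\esum_(i in [set: J]) (2 ^- (val i) * mdist (x i) (y i))%:E)%E.

Definition prod_dist x y : R := fine (prod_edist x y).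

Let w (i : J) : R := 2 ^- (val i).

Let w_gt0 i : 0 < w i.
Proof. by rewrite /w invr_gt0 exprn_gt0. Qed.

Let w_ge0 i : 0 <= w i.
Proof. exact: ltW. Qed.

Let term_ge0 x y i : (0 <= (w i * mdist (x i) (y i))%:E)%E.
Proof. by rewrite lee_fin mulr_ge0// mdist_ge0. Qed.

Let sum_cw (c : R) : 0 <= c ->
  (\esum_(i in [set: J]) (c * w i)%:E <= (c * 2)%:E)%E.
Proof.
move=> c0.
rewrite -(@esum_image R J nat setT val (fun n : nat => (c * 2 ^- n)%:E)); last first.
  by move=> i j _ _; exact: val_inj.
apply: (@le_trans _ _ (\sum_(i <oo) (c * 2 / (2 ^ i.+1)%:R)%:E)%E); last first.
  by apply: epsilon_trick0; rewrite mulr_ge0.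
rewrite nneseries_esumT; last by move=> n; rewrite lee_fin divr_ge0// mulr_ge0.
rewrite esum_mkcond; apply: le_esum => n _.
have -> : c * 2 / (2 ^ n.+1)%:R = c * 2 ^- n :> R.
  by rewrite natrX exprS invfM -mulrA (mulrA 2) divff ?mul1r.
by case: ifP => // _; rewrite lee_fin mulr_ge0// invr_ge0 exprn_ge0.
Qed.

Let sum_w : (\esum_(i in [set: J]) (w i)%:E <= 2%:E)%E.
Proof.
rewrite -[2]mul1r (le_trans _ (sum_cw ler01))//.
by apply: le_esum => i _; rewrite mul1r.
Qed.

Let sum_w_fin : (\esum_(i in [set: J]) (w i)%:E)%E \is a fin_num.
Proof.
rewrite ge0_fin_numE; first by apply: le_lt_trans sum_w _; exact: ltry.
by apply: esum_ge0 => i _; rewrite lee_fin.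
Qed.

Let prod_edist_ge0 x y : (0 <= prod_edist x y)%E.
Proof. by apply: esum_ge0 => i _; exact: term_ge0. Qed.

Lemma prod_edist_fin x y : prod_edist x y \is a fin_num.
Proof.
rewrite ge0_fin_numE//; apply: le_lt_trans (ltry 2); apply: le_trans sum_w.
by apply: le_esum => i _; rewrite lee_fin ler_piMr//; exact: bX.
Qed.

Lemma prod_dist_ge x y i : 2 ^- (val i) * mdist (x i) (y i) <= prod_dist x y.
Proof.
rewrite -lee_fin /prod_dist fineK ?prod_edist_fin//.
rewrite -(@esum_set1 R J i (fun i => (2 ^- (val i) * mdist (x i) (y i))%:E)).
  rewrite /prod_edist (@esumID _ _ [set i] setT); last first.
    by move=> j _; exact: term_ge0.
  by rewrite setTI leeDl//; apply: esum_ge0 => j _; exact: term_ge0.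
exact: term_ge0.
Qed.

Let prod_distxx x : prod_dist x x = 0.
Proof.
by rewrite /prod_dist /prod_edist esum1// => i _; rewrite mdistxx mulr0.
Qed.

Let prod_dist_positivity x y : prod_dist x y = 0 -> x = y.
Proof.
move=> xy0; apply: functional_extensionality_dep => i.
apply: mdist_positivity; apply/eqP; rewrite eq_le mdist_ge0 andbT.
by have := prod_dist_ge x y i; rewrite xy0 pmulr_rle0.
Qed.

Let prod_dist_sym x y : prod_dist x y = prod_dist y x.
Proof.
by congr fine; apply: eq_esum => i _; rewrite metric_sym.
Qed.

Let prod_dist_triangle y x z :
  prod_dist x z <= prod_dist x y + prod_dist y z.
Proof.
rewrite -lee_fin EFinD /prod_dist !fineK ?prod_edist_fin//.
rewrite /prod_edist -esumD; try by move=> i _; exact: term_ge0.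
apply: le_esum => i _; rewrite -EFinD lee_fin -mulrDr ler_wpM2l//.
exact: metric_triangle.
Qed.

HB.instance Definition _ := gen_eqMixin P.
HB.instance Definition _ := gen_choiceMixin P.
HB.instance Definition _ := isMetric.Build R P
  prod_distxx prod_dist_positivity prod_dist_sym prod_dist_triangle.

Lemma metric_prodE x y : mdist x y = prod_dist x y.
Proof. by []. Qed.

Definition prod_map (g : forall i, X i -> X i) : P -> P :=
  fun x i => g i (x i).

Let near_coord x i (A : set (X i)) :
  nbhs (x i) A -> \forall y \near x, A ((y : P) i).
Proof.
move=> /metricType_numDomainType.nbhs_mdistP[e /= e0 eA].
apply/metricType_numDomainType.nbhs_mdistP.
exists (w i * e) => /=; first by rewrite mulr_gt0.
move=> y; rewrite /= metric_prodE => xy; apply: eA => /=.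
by rewrite -(ltr_pM2l (w_gt0 i)); apply: le_lt_trans xy; exact: prod_dist_ge.
Qed.

Lemma prod_map_continuous (g : forall i, X i -> X i) :
  (forall i, continuous (g i)) -> continuous (prod_map g).
Proof.
move=> cg x; have FF : Filter (nbhs (x : P)) by exact: nbhs_filter.
apply/(metricType_numDomainType.cvgrPdist_lt (V := P)) => e e0.
have e20 : 0 < e / 2 by rewrite divr_gt0.
have e40 : 0 < e / 4 by rewrite divr_gt0.
have [_ [F [finF _] <-]] := ub_ereal_sup_adherent e20 sum_w_fin.
rewrite -/(esum _ _) => ltF.
have tail : (\esum_(i in ~` F) (w i)%:E < (e / 2)%:E)%E.
  have finS A : (\esum_(i in A) (w i)%:E)%E \is a fin_num.
    rewrite ge0_fin_numE; last by apply: esum_ge0 => i _; rewrite lee_fin.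
    apply: le_lt_trans (ltry 2); apply: le_trans sum_w.
    rewrite [leLHS]esum_mkcond; apply: le_esum => i _.
    by case: ifP => // _; rewrite lee_fin.
  move: ltF; rewrite -(@esum_fset R J F)//; last by move=> i _; rewrite lee_fin.
  rewrite (@esumID _ _ F setT); last by move=> i _; rewrite lee_fin.
  rewrite !setTI -addeA gteDl ?finS// -(fineK (finS (~` F))) -EFinB.
  by rewrite !lte_fin subr_lt0.
have nearF : \forall y \near x,
    forall i, F i -> mdist (g i (x i)) (g i ((y : P) i)) < e / 4.
  have : nbhs x (\bigcap_(i in [set` fset_set F])
      [set y : P | mdist (g i (x i)) (g i (y i)) < e / 4]).
    apply: filter_bigI => i _.
    apply: (@near_coord x i (fun t => mdist (g i (x i)) (g i t) < e / 4)).
    by move/metricType_numDomainType.cvgrPdist_lt : (cg i (x i)); exact.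
  apply: filterS => y yF i Fi; apply: yF => /=.
  by rewrite in_fset_set//; exact: mem_set.
near=> y.
have yF i : F i -> mdist (g i (x i)) (g i ((y : P) i)) < e / 4.
  by move: i; near: y.
rewrite metric_prodE -lte_fin /prod_dist fineK ?prod_edist_fin//.
rewrite /prod_edist (@esumID _ _ F setT); last by move=> i _; exact: term_ge0.
rewrite !setTI (splitr e) EFinD; apply: lee_ltD => //.
- rewrite ge0_fin_numE; last by apply: esum_ge0 => i _; exact: term_ge0.
  apply: le_lt_trans (ltry (prod_dist (prod_map g x) (prod_map g y))).
  rewrite /prod_dist fineK ?prod_edist_fin// esum_mkcond; apply: le_esum => i _.
  by case: ifP => // _; exact: term_ge0.
- have -> : e / 2 = e / 4 * 2 by field.
  apply: le_trans (sum_cw (ltW e40)).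
  rewrite esum_mkcond; apply: le_esum => i _; case: ifPn => [|_].
    by move=> /set_mem Fi; rewrite lee_fin mulrC ler_wpM2r//; exact/ltW/yF.
  by rewrite lee_fin mulr_ge0// ltW.
- apply: le_lt_trans tail; apply: le_esum => i _.
  by rewrite lee_fin ler_piMr//; exact: bX.
Unshelve. all: by end_near. Qed.

End metric_prod.

Section prod_homeo_group.
Context (R : realType) (J : set nat) (X : J -> metricType R).
Context (bX : forall i, bounded_by1 (X i)).
Context (G : forall i, homeo_group (X i)).

Definition prod_homeos : set (metric_prod bX -> metric_prod bX) :=
  [set prod_map g | g in [set g | forall i, homeos (G i) (g i)]].

Let prod_homeo_id : prod_homeos idfun.
Proof. by exists (fun i => idfun) => // i; exact: homeo_id. Qed.

Let prod_homeo_comp g h :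
  prod_homeos g -> prod_homeos h -> prod_homeos (g \o h).
Proof.
move=> [a Ga <-] [b Gb <-]; exists (fun i => a i \o b i) => // i.
exact: homeo_comp.
Qed.

Let prod_homeo_inv g : prod_homeos g ->
  exists h, [/\ prod_homeos h, cancel g h & cancel h g].
Proof.
move=> [a Ga <-].
pose b i := sval (cid (homeo_inv (Ga i))).
have bP i : [/\ homeos (G i) (b i), cancel (a i) (b i) & cancel (b i) (a i)].
  exact: (svalP (cid (homeo_inv (Ga i)))).
exists (prod_map b); split.
- by exists b => // i; case: (bP i).
- move=> x; apply: functional_extensionality_dep => i.
  by case: (bP i) => _ + _; exact.
- move=> x; apply: functional_extensionality_dep => i.
  by case: (bP i) => _ _; exact.
Qed.

Let prod_homeo_continuous g : prod_homeos g -> continuous g.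
Proof.
move=> [a Ga <-]; apply: prod_map_continuous => i.
exact: homeo_continuous (Ga i).
Qed.

Definition prod_homeo_group : homeo_group (metric_prod bX) :=
  HomeoGroup prod_homeo_id prod_homeo_comp prod_homeo_inv
    prod_homeo_continuous.

End prod_homeo_group.

(* Main.v *)
(* Sensitivity is inherited from the factor [X n].  Suppose a chaotic group is
   not sensitive.  By invariance every point [x0] with a dense orbit is then a
   point of equicontinuity of the group.  Let [y] be near [x0] with a closed
   orbit, and let [z], still closer to [x0], have a closed orbit as well.
   Elements [g] such that [g x0] tends to [y] keep [g z] in a compact set, so
   these points cluster at some [k z] in the closed orbit of [z]; hence
   [k^-1 (g x0)], and in the limit [k^-1 y], is close to [x0].  So [x0] lies in
   the closed orbit of [y], which contradicts the orbit of [x0] not being closed.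
   Chaos of the product group follows from the fact that the closure of a product
   of sets is the product of their closures. *)
Require Import Defs.
From mathcomp Require Import all_boot all_order all_algebra.
From mathcomp Require Import all_classical all_reals all_analysis.
From mathcomp Require Import lra.

Set Implicit Arguments.
Unset Strict Implicit.
Unset Printing Implicit Defensive.

Import Order.TTheory GRing.Theory Num.Theory.
Import numFieldNormedType.Exports.

Local Open Scope classical_set_scope.
Local Open Scope ring_scope.

(* [fingraph.orbit] shadows the orbits of a homeomorphism group. *)
Local Notation orbit := Defs.orbit.

Lemma choice_dep (I : Type) (T : I -> Type) (P : forall i, T i -> Prop) :
  (forall i, exists x, P i x) -> exists f, forall i, P i (f i).
Proof. by move=> PT; exists (fun i => sval (cid (PT i))) => i; case: cid. Qed.

Lemma denseP (T : topologicalType) (S : set T) :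
  dense S <-> forall p, closure S p.
Proof.
split=> [dS p B | cS U [p Up] oU].
  rewrite nbhsE => -[C [oC Cp] CB].
  have [q [Cq Sq]] := dS C (ex_intro _ p Cp) oC.
  by exists q; split => //; exact: CB.
have [q [Sq Uq]] := cS p U (open_nbhs_nbhs (conj oU Up)).
by exists q.
Qed.

(** * Neighbourhoods, closure, continuity and diameter in terms of the distance *)

Section metric.
Context (R : realType) (T : metricType R).
Implicit Types (x y z p : T) (A U : set T).

Lemma nbhs_mdist x A :
  nbhs x A <-> exists2 e : R, 0 < e & forall y, mdist x y < e -> A y.
Proof. exact: metricType_numDomainType.nbhs_mdistP. Qed.

Lemma open_mdist_lt x (e : R) : open [set y | mdist x y < e].
Proof.
rewrite openE => y /= xy; apply/nbhs_mdist.
exists (e - mdist x y); first by rewrite subr_gt0.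
by move=> z yz /=; have := metric_triangle x y z; lra.
Qed.

Lemma closure_mdistP A p :
  closure A p <-> forall e : R, 0 < e -> exists2 a, A a & mdist p a < e.
Proof.
split=> [cA e e0|cA B /nbhs_mdist[e /cA[a Aa pa] eB]].
  have [|a [Aa pa]] := cA [set a | mdist p a < e]; last by exists a.
  by apply/nbhs_mdist; exists e.
by exists a; split => //; exact: eB.
Qed.

Lemma continuous_mdistP (f : T -> T) x : {for x, continuous f} ->
  forall e : R, 0 < e ->
  exists2 d : R, 0 < d & forall y, mdist x y < d -> mdist (f x) (f y) < e.
Proof.
move=> cf e e0; apply/nbhs_mdist.
exact: (proj1 (metricType_numDomainType.cvgrPdist_lt f (f x)) cf).
Qed.

Lemma mdist_le_diam A x y : A x -> A y -> ((mdist x y)%:E <= diam A)%E.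
Proof. by move=> Ax Ay; apply: ereal_sup_ubound; exists (x, y). Qed.

Lemma lt_diam A (e : R) : (e%:E < diam A)%E ->
  exists x y, [/\ A x, A y & e < mdist x y].
Proof.
by move=> /ereal_sup_gt[_ [[x y] [/= Ax Ay] <-]]; rewrite lte_fin; exists x, y.
Qed.

End metric.

(** * A chaotic group on a locally compact metric space *)

Section orbits.
Context (R : realType) (T : metricType R) (G : homeo_group T).
Implicit Types x y z : T.

Lemma orbit_refl x : orbit G x x.
Proof. by exists idfun => //; exact: homeo_id. Qed.

Lemma orbit_eq x y : orbit G x y -> orbit G y = orbit G x.
Proof.
move=> [h Gh <-]; apply/seteqP; split => [_ [g Gg <-]|_ [g Gg <-]].
  by exists (g \o h) => //; exact: homeo_comp.
have [h' [Gh' hK _]] := homeo_inv Gh.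
by exists (g \o h'); [exact: homeo_comp|rewrite /= hK].
Qed.

(** Orbits partition the space, so density of the union gives approximation by points whose own
    orbits are closed. *)
Lemma bigcup_closed_orbit :
  \bigcup_(x in [set x | closed_orbit G x]) orbit G x =
  [set x | closed_orbit G x].
Proof.
apply/seteqP; split => [y [x cx /orbit_eq xy]|x cx].
  by rewrite /= /closed_orbit xy.
by exists x => //; exact: orbit_refl.
Qed.

(** If no [r] worked, [d] would be a sensitivity constant: an open [U] contains some [h x], [h] maps
    a small ball about [x] into [U], and a pair of that ball separated by [g] gives a pair of [U]
    separated by [g] after the inverse of [h]. *)
Lemma dense_orbit_equicontinuous x : ~ sensitive G -> dense (orbit G x) ->
  forall d : R, 0 < d -> exists2 r : R, 0 < r &
    forall g a b, homeos G g -> mdist x a < r -> mdist x b < r ->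
      mdist (g a) (g b) < d.
Proof.
move=> nsG dx d d0; apply: contrapT => nr; apply: nsG.
exists d => // U oU U0; apply: contrapT => nU; apply: nr.
have [u [+ [h Gh hx]]] := dx U U0 oU.
rewrite -{u}hx => Uhx.
have [h' [Gh' hK h'K]] := homeo_inv Gh.
have [r r0 rU] : exists2 r : R, 0 < r & forall a, mdist x a < r -> U (h a).
  apply/nbhs_mdist; apply: (homeo_continuous Gh).
  exact: open_nbhs_nbhs.
exists r => // g a b Gg xa xb; rewrite ltNge; apply/negP => dab.
apply: nU; exists (g \o h'); first exact: homeo_comp.
apply: (@le_trans _ _ (mdist (g a) (g b))%:E); first by rewrite lee_fin.
by apply: mdist_le_diam; [exists (h a)|exists (h b)];
  rewrite /= ?hK//; exact: rU.
Qed.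

Lemma closed_orbit_cluster y z x (K : set T) (e0 : R) :
    compact K -> closed_orbit G z -> dense (orbit G x) -> 0 < e0 ->
    (forall g, homeos G g -> mdist y (g x) < e0 -> K (g z)) ->
  exists2 k, homeos G k & forall N (e : R), nbhs (k z) N -> 0 < e ->
    exists g, [/\ homeos G g, mdist y (g x) < e & N (g z)].
Proof.
move=> cK cz dx e00 gK.
(* The sets [B e] form a filter base of nonempty sets, since the orbit of [x] comes arbitrarily
   close to [y]. *)
pose B (e : R) := [set g z | g in [set g | homeos G g /\ mdist y (g x) < e]].
pose F := filter_from [set e : R | 0 < e] B.
have FF : ProperFilter F.
  apply: filter_from_proper.
    apply: filter_from_filter; first by exists 1 => /=.
    move=> i j /= i0 j0; exists (Num.min i j).
      by rewrite /= lt_min i0.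
    move=> _ [g [Gg +] <-]; rewrite lt_min => /andP[gi gj].
    by split; exists g.
  move=> e /= e_gt0.
  have /denseP/(_ y)/closure_mdistP/(_ e e_gt0)[_ [g Gg <-] yg] := dx.
  by exists (g z), g.
have FK : F K by exists e0 => //= _ [g [Gg ge] <-]; exact: gK.
have [w [_ Fw]] := cK F FF FK.
have : closure (orbit G z) w.
  move=> N Nw; apply: Fw Nw.
  by exists 1 => //= _ [g [Gg _] <-]; exists g.
move: (cz) => /closure_id <- [k Gk kw].
exists k => // N e Nk e_gt0.
have [] := Fw (B e) N; first by exists e.
  by rewrite -kw.
by move=> _ [[g [Gg ge] <-] Ng]; exists g.
Qed.

Lemma chaotic_sensitive :
  locally_compact [set: T] -> chaotic G -> sensitive G.
Proof.
move=> lcT [[x0 [dx ncx]]]; rewrite bigcup_closed_orbit => dc.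
apply: contrapT => nsG.
have equi := dense_orbit_equicontinuous nsG dx.
have near_closed (e : R) : 0 < e -> exists2 z, closed_orbit G z & mdist x0 z < e.
  by move=> e0; have /denseP/(_ x0)/closure_mdistP/(_ e e0) := dc.
have [K xK [cK _]] := lcT x0 I.
have [e0 e00 eK] : exists2 e : R, 0 < e & forall y, mdist x0 y < e -> K y.
  by apply/nbhs_mdist; move: xK; rewrite withinET.
(* The path from [x0] through [y] and [g x0] to [g z] has three steps shorter than [e], which keeps
   [g z] in [K]. *)
pose e := e0 / 3.
have e_gt0 : 0 < e by rewrite /e; lra.
have [y cy xy] := near_closed _ e_gt0.
suff : orbit G y x0.
  by move=> /orbit_eq xyE; apply: ncx; rewrite /closed_orbit xyE.
move: (cy) => /closure_id ->; apply/closure_mdistP => rho rho0.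
(* The bound [e] serves the compactness argument, the bound [rho / 4] the final four-term
   estimate. *)
pose eta := Num.min e (rho / 4).
have eta0 : 0 < eta by rewrite lt_min e_gt0/=; lra.
have [eta_e eta_rho] : eta <= e /\ eta <= rho / 4 by rewrite !ge_min !lexx orbT.
have [r r0 Hr] := equi _ eta0.
have m0 : 0 < Num.min r eta by rewrite lt_min r0.
have [z cz] := near_closed _ m0; rewrite lt_min => /andP[xz_r xz_eta].
have x0r : mdist x0 x0 < r by rewrite mdistxx.
have [g Gg yg|k Gk Hk] := closed_orbit_cluster (y := y) cK cz dx e_gt0.
  apply: eK; have := Hr g x0 z Gg x0r xz_r.
  have := metric_triangle x0 y (g z); have := metric_triangle y (g x0) (g z).
  by rewrite /e in xy yg eta_e *; lra.
have [k' [Gk' kK k'K]] := homeo_inv Gk.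
have rho4 : 0 < rho / 4 by lra.
have [d d0 Hd] := continuous_mdistP (homeo_continuous Gk' (x := y)) rho4.
have [|g [Gg ygd zg]] := Hk [set u | mdist z (k' u) < rho / 4] d _ d0.
  apply/nbhs_mdist.
  have [d' d'0 Hd'] :=
    continuous_mdistP (homeo_continuous Gk' (x := k z)) rho4.
  by exists d' => // u /Hd'; rewrite kK.
exists (k' y); first by exists k'.
(* The radius [r] was fixed before [k'] and [g] were found; it applies to their composite because it
   is uniform over the group. *)
have := Hr (k' \o g) z x0 (homeo_comp Gk' Gg) xz_r x0r.
have := Hd _ ygd; rewrite metric_sym /= in zg *.
have := metric_triangle x0 z (k' y).
have := metric_triangle z (k' (g z)) (k' y).
have := metric_triangle (k' (g z)) (k' (g x0)) (k' y).
move: zg; rewrite /=; lra.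
Qed.

End orbits.

(** * Products of sets, orbits and groups *)

Section product.
Context (R : realType) (J : set nat) (X : J -> metricType R).
Context (bX : forall i, bounded_by1 (X i)).
Local Notation P := (metric_prod bX).
Implicit Types x y z : P.

Lemma prod_mdist_ge x y i : 2 ^- (val i) * mdist (x i) (y i) <= mdist x y.
Proof. exact: prod_dist_ge. Qed.

Lemma prod_mdist_le x y (c : R) :
  (forall i, mdist (x i) (y i) <= c) -> 0 <= c -> mdist x y <= c * 2.
Proof.
move=> xyc c0; rewrite metric_prodE -lee_fin fineK ?prod_edist_fin//.
have c20 : 0 <= c * 2 by rewrite mulr_ge0.
apply: le_trans (epsilon_trick0 xpredT c20).
(* This is [c] times the weight of index [k]; summed over all naturals from 0, it gives at most
   [c * 2]. *)
pose f k : \bar R := (c * 2 / (2 ^ k.+1)%:R)%:E.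
have f0 k : (0 <= f k)%E by rewrite lee_fin divr_ge0// mulr_ge0.
apply: (@le_trans _ _ (\esum_(i in [set: J]) f (val i))%E).
  apply: le_esum => i _; rewrite lee_fin mulrC natrX exprS invfM.
  by rewrite -mulrA (mulrA 2) divff// mul1r ler_wpM2r// invr_ge0 exprn_ge0.
rewrite -(@esum_image R J nat setT val f); last first.
  by move=> i j _ _; exact: val_inj.
rewrite nneseries_esumT// esum_mkcond; apply: le_esum => k _.
by case: ifP => _; [exact: lexx|exact: f0].
Qed.

Definition box (A : forall i, set (X i)) : set P := [set x | forall i, A i (x i)].

Lemma closure_box (A : forall i, set (X i)) :
  closure (box A) = box (fun i => closure (A i)).
Proof.
apply/seteqP; split => [x /closure_mdistP cx i|x cx].
  apply/closure_mdistP => e e0.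
  have w0 : 0 < 2 ^- val i :> R by rewrite invr_gt0 exprn_gt0.
  have [a Aa xa] := cx _ (mulr_gt0 w0 e0); exists (a i) => //.
  by rewrite -(ltr_pM2l w0); exact: le_lt_trans (prod_mdist_ge x a i) xa.
apply/closure_mdistP => e e0.
have e4 : 0 < e / 4 by lra.
have /choice_dep[a Ha] i : exists a, A i a /\ mdist (x i) a < e / 4.
  by have /closure_mdistP/(_ _ e4)[a] := cx i; exists a.
exists (a : P) => [i|]; first by case: (Ha i).
apply: (@le_lt_trans _ _ (e / 4 * 2)); last by lra.
by apply: prod_mdist_le => [i|]; [case: (Ha i) => _ /ltW|exact: ltW].
Qed.

Lemma dense_box (A : forall i, set (X i)) :
  (forall i, dense (A i)) -> dense (box A).
Proof.
by move=> dA; apply/denseP => x; rewrite closure_box => i; apply: (denseP _).1.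
Qed.

Context (G : forall i, homeo_group (X i)).
Local Notation GP := (prod_homeo_group bX G).

Lemma orbit_prod x : orbit GP x = box (fun i => orbit (G i) (x i)).
Proof.
apply/seteqP; split => [_ [_ [g Gg <-] <-] i|y xy].
  by exists (g i).
have /choice_dep[g Hg] i : exists g, homeos (G i) g /\ g (x i) = y i.
  by have [g] := xy i; exists g.
exists (prod_map (bX := bX) g).
  by exists g => // i; case: (Hg i).
by apply: functional_extensionality_dep => i; case: (Hg i).
Qed.

Lemma closed_orbit_prod x :
  closed_orbit GP x <-> forall i, closed_orbit (G i) (x i).
Proof.
rewrite /closed_orbit orbit_prod; split=> [cx i|cx]; last first.
  move=> y; rewrite closure_box => cy i; exact: cx.
(* Replacing only coordinate [i] of [x] by [z] reduces closedness in one factor to closedness in the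
   product. *)
move=> z cz; have : closure (box (fun j => orbit (G j) (x j))) (dfwith x i z).
  rewrite closure_box => j; case: dfwithP => // k _.
  exact/subset_closure/orbit_refl.
by move=> /cx /(_ i); rewrite dfwithin.
Qed.

(** The index [n] makes the dense orbit non-closed: over an empty index set the product is a single
    point. *)
Lemma prod_chaotic (n : J) : (forall i, chaotic (G i)) -> chaotic GP.
Proof.
move=> cG; split.
  have /choice_dep[x Hx] i : exists t,
    dense (orbit (G i) t) /\ ~ closed_orbit (G i) t by case: (cG i).
  exists (x : P); rewrite orbit_prod closed_orbit_prod; split.
    by apply: dense_box => i; case: (Hx i).
  by move=> /(_ n); case: (Hx n).
rewrite bigcup_closed_orbit.
have -> : [set x | closed_orbit GP x] =
    box (fun i => [set t | closed_orbit (G i) t]).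
  by apply/seteqP; split => x /closed_orbit_prod.
by apply: dense_box => i; rewrite -bigcup_closed_orbit; case: (cG i).
Qed.

(** Only coordinate [n] is varied and moved, so distances there reappear scaled by its weight. *)
Lemma prod_sensitive (n : J) : sensitive (G n) -> sensitive GP.
Proof.
move=> [d d0 sG]; pose w : R := 2 ^- val n.
have w0 : 0 < w by rewrite invr_gt0 exprn_gt0.
(* A diameter need not be attained; halving [d] provides an actual pair of points. *)
exists (w * (d / 2)) => [|U oU [y Uy]]; first by rewrite mulr_gt0//; lra.
have /nbhs_mdist[e e0 eU] : nbhs y U by exact: open_nbhs_nbhs.
pose V := [set t | mdist (y n) t < e / 4].
have UV t : V t -> U (dfwith y n t).
  move=> Vt; apply: eU; apply: (@le_lt_trans _ _ (e / 4 * 2)); last by lra.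
  apply: prod_mdist_le => [i|]; last by lra.
  by case: dfwithP => [|j _]; [exact: ltW|rewrite mdistxx; lra].
have [|g Gg dV] := sG V (open_mdist_lt (y n) (e / 4)).
  by exists (y n); rewrite /V/= mdistxx; lra.
have [_ [_ [[a Va <-] [b Vb <-] gab]]] : exists s t,
    [/\ (g @` V) s, (g @` V) t & d / 2 < mdist s t].
  by apply: lt_diam; apply: lt_le_trans dV; rewrite lte_fin; lra.
pose gP := prod_map (bX := bX) (dfwith (fun i => idfun) n g).
exists gP.
  exists (dfwith (fun i => idfun) n g) => // i; case: dfwithP => // j _.
  exact: homeo_id.
apply: (@le_trans _ _ (mdist (gP (dfwith y n a)) (gP (dfwith y n b)))%:E).
  rewrite lee_fin; apply: le_trans (prod_mdist_ge _ _ n).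
  by rewrite /gP /prod_map !dfwithin ler_pM2l// ltW.
by apply: mdist_le_diam; [exists (dfwith y n a)|exists (dfwith y n b)] => //;
  exact: UV.
Qed.

End product.

Theorem theorem7p2 (R : realType) (J : set nat)
    (J_pos : J `<=` [set i | (0 < i)%N])
    (X : J -> metricType R) (bX : forall i, bounded_by1 (X i))
    (G : forall i, homeo_group (X i)) (chaoticG : forall i, chaotic (G i))
    (exn : exists n : J,
      locally_compact [set: X n] /\ Baire_space (X n)) :
  chaotic (prod_homeo_group bX G) /\ sensitive (prod_homeo_group bX G).
Proof.
have [n [lcX _]] := exn; split; first exact: (@prod_chaotic _ _ _ _ _ n).
by apply: (@prod_sensitive _ _ _ _ _ n); exact: chaotic_sensitive.
Qed.
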